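(* Let $d \geq 1$ and let $V \subset \mathbb{R}^d$ be an almost-equidistant diameter set, i.e. an almost-equidistant set of diameter $1$. Then $V$ has at most $2d+4$ points.
   Context: A set $V \subset \mathbb{R}^d$ is called almost-equidistant if among any three distinct points of $V$, some two are at (Euclidean) distance exactly $1$ apart. The diameter of $V$ is the supremum of the Euclidean distances between its points. An almost-equidistant diameter set is a set that is almost-equidistant and has diameter $1$. *)

(* Defs.v *)
From HB Require Import structures.
From mathcomp Require Import all_boot all_order all_algebra.
From mathcomp Require Import mathcomp_extra boolp classical_sets functions.
From mathcomp Require Import cardinality reals constructive_ereal ereal.

Set Implicit Arguments.
Unset Strict Implicit.
Unset Printing Implicit Defensive.

Import Order.TTheory GRing.Theory Num.Theory.

Local Open Scope classical_set_scope.
Local Open Scope ring_scope.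

(* The norm that MathComp-Analysis puts on 'rV[R]_d is the sup norm, hence the
   explicit Euclidean distance. *)
Definition edist (R : realType) (d : nat) (x y : 'rV[R]_d) : R :=
  Num.sqrt (\sum_(i < d) (x ord0 i - y ord0 i) ^+ 2).

(* Extended-real valued: +oo for an unbounded set, -oo for the empty set. *)
Definition diameter (R : realType) (d : nat) (V : set 'rV[R]_d) : \bar R :=
  ereal_sup [set (edist p.1 p.2)%:E | p in V `*` V].

Definition almost_equidistant (R : realType) (d : nat) (V : set 'rV[R]_d) :
    Prop :=
  forall x y z : 'rV[R]_d, V x -> V y -> V z ->
    x <> y -> y <> z -> x <> z ->
    edist x y = 1 \/ edist y z = 1 \/ edist x z = 1.

Definition almost_equidistant_diameter_set (R : realType) (d : nat)
    (V : set 'rV[R]_d) : Prop :=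
  almost_equidistant V /\ diameter V = 1%:E.

(* Main.v *)
Require Import Defs.
From mathcomp Require Import all_boot all_order all_algebra.
From mathcomp Require Import boolp classical_sets functions cardinality reals.
From mathcomp Require Import constructive_ereal ereal.
From mathcomp Require Import complex ring zify.

(* For points p_i of the set, put A_ij = 1 - |p_i - p_j|^2 and B = A - I. The
   diameter condition makes B entrywise nonnegative, and almost-equidistance
   says that the support of B is a triangle-free graph, so tr B = tr B^3 = 0.
   Expanding squared distances gives A = N N^T - a a^T with N having d + 1
   columns: A has rank at most d + 2 and at most one negative eigenvalue.
   Sum g(x) = x^3 - 3 x + 2 = (x - 1)^2 (x + 2) over the eigenvalues x of B: the
   total is 2 n, the eigenvalue -1, of multiplicity at least n - d - 2,
   contributes 4 each time, and g >= 0 on [-1, +oo). The possible eigenvalue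
   x < -1 is compensated: by Perron-Frobenius there is an eigenvalue y >= -x,
   and then g(x) + g(y) >= 4. Hence 4 (n - d - 2) <= 2 n. *)

Set Implicit Arguments.
Unset Strict Implicit.
Unset Printing Implicit Defensive.

Import Order.TTheory GRing.Theory Num.Theory.

Local Open Scope ring_scope.
Local Open Scope sesquilinear_scope.

(** * Diagonal matrices: rank and Hermitian forms *)

Lemma mxrank_diag_ge (F : fieldType) (n : nat) (D : 'rV[F]_n) :
  (#|[set k | (D 0 k != 0)%R]| <= \rank (diag_mx D))%N.
Proof.
set S := [set k | _].
(* [N] selects the nonzero diagonal entries and [M] also inverts them, so [M *m diag_mx D *m N] is
   the identity of size [#|S|]. *)
pose M : 'M[F]_(#|S|, n) :=
  \matrix_(i, k) ((D 0 k)^-1 * (k == enum_val i)%:R).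
pose N : 'M[F]_(n, #|S|) := \matrix_(k, i) (k == enum_val i)%:R.
apply: (@mulmx1_min_rank _ _ _ _ _ M N).
apply/matrixP=> i j; rewrite mul_mx_diag !mxE (bigD1 (enum_val i)) //=.
rewrite big1 ?addr0 => [|k /negPf neq_ki]; last first.
  by rewrite !mxE neq_ki !(mulr0, mul0r).
have := enum_valP i; rewrite inE => Di.
by rewrite !mxE eqxx mulr1 mulVf // mul1r (inj_eq enum_val_inj).
Qed.

Lemma sqnormE (C : numClosedFieldType) (n : nat) (u : 'rV[C]_n) :
  (u *m u^t*) 0 0 = \sum_k `|u 0 k| ^+ 2.
Proof. by rewrite mxE; apply: eq_bigr => k _; rewrite !mxE normCK. Qed.

Lemma sqnorm_ge0 (C : numClosedFieldType) (n : nat) (u : 'rV[C]_n) :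
  0 <= (u *m u^t*) 0 0.
Proof. by rewrite sqnormE sumr_ge0 // => k _; rewrite exprn_ge0. Qed.

Lemma diag_formE (C : numClosedFieldType) (n : nat) (X u : 'rV[C]_n) :
  (u *m diag_mx X *m u^t*) 0 0 = \sum_k X 0 k * `|u 0 k| ^+ 2.
Proof.
rewrite mul_mx_diag mxE; apply: eq_bigr => k _; rewrite !mxE normCK.
by rewrite -mulrA mulrCA.
Qed.

(** * Spectrum of a symmetric, entrywise nonnegative matrix *)

Section SymmetricNonnegative.
Variables (C : numClosedFieldType) (n : nat) (B : 'M[C]_n).
Hypothesis B_sym : B^T = B.
Hypothesis B_ge0 : forall i j, 0 <= B i j.
Let P := spectralmx B.
Let X := spectral_diag B.

Let P_unitary : P \is unitarymx. Proof. exact: spectral_unitarymx. Qed.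

Let B_herm : B \is hermsymmx.
Proof.
apply: realsym_hermsym.
  by apply/is_hermitianmxP; rewrite expr0 scale1r map_mx_id // B_sym.
by apply/mxOverP => i j; rewrite ger0_real.
Qed.

Lemma spectral_real k : X 0 k \is Num.real.
Proof. exact: (mxOverP (hermitian_spectral_diag_real B_herm)). Qed.

Lemma spectralE : B = P^t* *m diag_mx X *m P.
Proof.
by rewrite {1}(orthomx_spectralP (hermitian_normalmx B_herm)) invmx_unitary.
Qed.

Let PPt : P *m P^t* = 1%:M. Proof. exact/unitarymxP. Qed.

Let PtP : P^t* *m P = 1%:M.
Proof. by rewrite -invmx_unitary // mulVmx ?unitarymx_unit. Qed.

Lemma spectral_formE (u : 'rV[C]_n) :
  (u *m B *m u^t*) 0 0 = \sum_k X 0 k * `|(u *m P^t*) 0 k| ^+ 2.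
Proof.
by rewrite -diag_formE trmx_mul map_mxM trmxCK {1}spectralE !mulmxA.
Qed.

Lemma spectral_sqnorm (u : 'rV[C]_n) :
  (u *m u^t*) 0 0 = \sum_k `|(u *m P^t*) 0 k| ^+ 2.
Proof.
by rewrite -sqnormE trmx_mul map_mxM trmxCK -!mulmxA (mulmxA _ P) PtP mul1mx.
Qed.

Lemma spectral_trace : \tr B = \sum_k X 0 k.
Proof. by rewrite {1}spectralE mxtrace_mulC mulmxA PPt mul1mx mxtrace_diag. Qed.

Lemma spectral_trace3 : \tr (B *m B *m B) = \sum_k X 0 k ^+ 3.
Proof.
have -> : B *m B *m B =
    P^t* *m (diag_mx X *m diag_mx X *m diag_mx X) *m P.
  rewrite spectralE !mulmxA.
  by do 2!rewrite -(mulmxA _ P (P^t*)) PPt mulmx1.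
rewrite mxtrace_mulC mulmxA PPt mul1mx !mulmx_diag mxtrace_diag.
by apply: eq_bigr => k _; rewrite !mxE -mulrA exprS expr2.
Qed.

(** Conjugation by the unitary [P] makes [B + c%:M] diagonal without changing its rank. For [c = 1]
    a small rank forces many eigenvalues [-1]. *)
Lemma spectral_rank (c : C) :
  (#|[set k | (X 0 k + c != 0)%R]| <= \rank (B + c%:M)%R)%N.
Proof.
have -> : B + c%:M = P^t* *m diag_mx (\row_k (X 0 k + c)) *m P.
  have -> : diag_mx (\row_k (X 0 k + c)) = diag_mx X + c%:M.
    by apply/matrixP=> i j; rewrite !mxE -mulrnDl.
  rewrite mulmxDr mulmxDl -spectralE mul_mx_scalar -scalemxAl PtP.
  by rewrite scalemx1.
have Pu := unitarymx_unit P_unitary.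
rewrite mxrankMfree ?row_free_unit // eqmxMfull ?row_full_unit; last first.
  by rewrite -invmx_unitary // unitmx_inv.
apply: leq_trans (mxrank_diag_ge _).
by apply/subset_leq_card/fintype.subsetP=> k; rewrite !inE mxE.
Qed.

(* Perron-Frobenius: replacing the entries of a unit eigenvector by their
   absolute values can only increase the modulus of the quadratic form. *)
Lemma spectral_perron (j : 'I_n) : X 0 j < 0 -> exists k, 0 <= X 0 j + X 0 k.
Proof.
move=> Xj_lt0.
have [/existsP[k ?]|/existsPn noK] := boolP [exists k, 0 <= X 0 j + X 0 k].
  by exists k.
have {}noK k : 0 < - (X 0 j + X 0 k).
  by rewrite oppr_gt0 real_ltNge ?noK ?realD ?spectral_real ?real0.
pose p := row j P; pose v : 'rV[C]_n := \row_i `|p 0 i|.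
have pPt : p *m P^t* = 'e_j by rewrite -row_mul PPt row1.
have p_form : (p *m B *m p^t*) 0 0 = X 0 j.
  rewrite spectral_formE pPt (bigD1 j) //= big1 => [|k /negPf jk].
    by rewrite !mxE !eqxx normr1 expr1n mulr1 addr0.
  by rewrite !mxE jk andbF normr0 expr0n mulr0.
have p_norm : (p *m p^t*) 0 0 = 1.
  rewrite spectral_sqnorm pPt (bigD1 j) //= big1 => [|k /negPf jk].
    by rewrite !mxE !eqxx normr1 expr1n addr0.
  by rewrite !mxE jk andbF normr0 expr0n.
have v_norm : (v *m v^t*) 0 0 = 1.
  by rewrite -p_norm !sqnormE; apply: eq_bigr => k _; rewrite !mxE normr_id.
have v_form : - X 0 j <= (v *m B *m v^t*) 0 0.
  rewrite -(ltr0_norm Xj_lt0) -p_form !mxE.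
  apply: le_trans (ler_norm_sum _ _ _) _.
  apply: ler_sum => k _; rewrite !mxE normrM norm_conjC conj_normC.
  rewrite ler_wpM2r //; apply: le_trans (ler_norm_sum _ _ _) _.
  by apply: ler_sum => i _; rewrite !mxE normrM (ger0_norm (B_ge0 _ _)).
(* In the eigenbasis, [- X 0 j] times the squared norm of [v] minus the form at [v] has strictly
   positive weights. By [v_form] it is nonpositive, so the unit vector [v] would vanish. *)
have w_ge0 k : true -> 0 <= - (X 0 j + X 0 k) * `|(v *m P^t*) 0 k| ^+ 2.
  by move=> _; rewrite mulr_ge0 ?exprn_ge0 // ltW.
have sum_le0 : \sum_k - (X 0 j + X 0 k) * `|(v *m P^t*) 0 k| ^+ 2 <= 0.
  under eq_bigr => k _ do rewrite opprD mulrDl.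
  rewrite big_split /= -mulr_sumr -spectral_sqnorm v_norm mulr1.
  under [X in _ + X]eq_bigr => k _ do rewrite mulNr.
  by rewrite sumrN -spectral_formE subr_le0.
have /eqP sum_eq0 : \sum_k - (X 0 j + X 0 k) * `|(v *m P^t*) 0 k| ^+ 2 == 0.
  by rewrite eq_le sum_le0 sumr_ge0.
have := oner_eq0 C; rewrite -v_norm spectral_sqnorm big1 ?eqxx // => k _.
have /eqP := psumr_eq0P w_ge0 sum_eq0 (i := k) isT.
by rewrite mulf_eq0 gt_eqF //= => /eqP.
Qed.

(* Two such eigenvectors would span a vector killed by a, on which the form
   is both negative and nonnegative. *)
Lemma spectral_one_negative (m : nat) (c : C) (M : 'M[C]_(n, m)) (a : 'cV[C]_n)
    (j k : 'I_n) :
  B + c%:M = M *m M^t* - a *m a^t* ->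
  X 0 j + c < 0 -> X 0 k + c < 0 -> j = k.
Proof.
move=> BE Xj Xk; apply/eqP/negP => /negP jk.
have [w w_neq0 [w_supp wa]] : exists2 w : 'rV[C]_n, w != 0 &
    (forall i, w 0 i != 0 -> X 0 i + c < 0) /\ w *m P *m a = 0.
  (* For a vector with eigenbasis coordinates [w], the product with [a] is [w *m b]. If the [j]-th
     entry of [b] is zero, ['e_j] works; otherwise the two entries of [b] are crossed. *)
  pose b := P *m a.
  have [bj0|bj0] := eqVneq (b j 0) 0.
    exists 'e_j.
      by apply/eqP=> /rowP/(_ j)/eqP; rewrite !mxE !eqxx oner_eq0.
    split=> [i|].
      by rewrite !mxE eqxx /=; case: (i =P j) => [->|] //= _; rewrite eqxx.
    by apply/matrixP=> x y; rewrite -mulmxA -rowE !ord1 mxE bj0 mxE.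
  exists (b k 0 *: 'e_j - b j 0 *: 'e_k).
    move: (b j 0) (b k 0) bj0 => s t s_neq0.
    apply/eqP=> /rowP/(_ k)/eqP; rewrite !mxE !eqxx (eq_sym k) (negPf jk).
    by rewrite mulr0 mulr1 sub0r oppr_eq0 (negPf s_neq0).
  split=> [i|].
    rewrite !mxE eqxx /=.
    case: (i =P j) => [->|] //= _; case: (i =P k) => [->|] //= _.
    by rewrite !mulr0 subr0 eqxx.
  rewrite -mulmxA mulmxBl -!scalemxAl -!rowE.
  by apply/matrixP=> x y; rewrite !ord1 !mxE mulrC subrr.
pose u := w *m P.
have uPt : u *m P^t* = w by rewrite /u -mulmxA PPt mulmx1.
(* Since [u *m a = 0], only the square norm of [u *m M] remains. *)
have form_ge0 : 0 <= (u *m (B + c%:M) *m u^t*) 0 0.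
  rewrite BE mulmxBr mulmxBl !mulmxA wa !mul0mx subr0.
  by rewrite -(mulmxA _ (M^t*)) -map_mxM -trmx_mul sqnorm_ge0.
have term_le0 i : true -> 0 <= - (X 0 i + c) * `|w 0 i| ^+ 2.
  move=> _; have [->|/w_supp/ltW ?] := eqVneq (w 0 i) 0.
    by rewrite normr0 expr0n mulr0.
  by rewrite mulr_ge0 ?exprn_ge0 ?oppr_ge0.
have sumE : \sum_i - (X 0 i + c) * `|w 0 i| ^+ 2 =
    - (u *m (B + c%:M) *m u^t*) 0 0.
  rewrite mulmxDr mulmxDl mxE mul_mx_scalar -scalemxAl [X in _ + X]mxE.
  rewrite spectral_formE spectral_sqnorm uPt mulr_sumr -big_split -sumrN /=.
  by apply: eq_bigr => i _; rewrite -mulrDl mulNr.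
have /eqP sum_eq0 : \sum_i - (X 0 i + c) * `|w 0 i| ^+ 2 == 0.
  by rewrite eq_le sumr_ge0 // andbT sumE oppr_le0.
case/eqP: w_neq0; apply/rowP=> i; rewrite mxE; apply/eqP/negPn/negP => wi.
have /eqP := psumr_eq0P term_le0 sum_eq0 (i := i) isT.
by rewrite mulf_eq0 oppr_eq0 lt_eqF ?w_supp //= expf_eq0 normr_eq0 (negPf wi).
Qed.

End SymmetricNonnegative.

(** * The cubic weight and the spectral bound *)

Lemma cubic_ge0 (C : numClosedFieldType) (x : C) :
  -1 <= x -> 0 <= x ^+ 3 - 3 * x + 2.
Proof.
move=> x_ge; have -> : x ^+ 3 - 3 * x + 2 = (x - 1) ^+ 2 * (x + 1 + 1) by ring.
have x1_ge0 : 0 <= x + 1 by rewrite -lerBlDr sub0r.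
apply: mulr_ge0; last by rewrite addr_ge0.
(* The order of [C] is partial: [x] is real because [x + 1] is nonnegative, and only then is the
   square known to be nonnegative. *)
rewrite real_exprn_even_ge0 // rpredB ?real1 //.
by rewrite -(addrK 1 x) rpredB ?real1 ?ger0_real.
Qed.

(** In the nonnegative quantities [s = x + y] and [t = - 1 - x], the difference of the two sides is
    a polynomial with nonnegative coefficients. *)
Lemma cubic_pair_ge4 (C : numClosedFieldType) (x y : C) :
  x < -1 -> 0 <= x + y -> 4 <= (x ^+ 3 - 3 * x + 2) + (y ^+ 3 - 3 * y + 2).
Proof.
move=> x_lt xy; rewrite -subr_ge0.
have x1 : 0 <= - 1 - x by rewrite subr_ge0 ltW.
have -> : x ^+ 3 - 3 * x + 2 + (y ^+ 3 - 3 * y + 2) - 4 =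
    (x + y) * ((x + y) ^+ 2 + 3 * ((- 1 - x + 1) * (x + y) +
    (- 1 - x) * ((- 1 - x) + 2))) by ring.
move: (x + y) (- 1 - x) xy x1 => s t s_ge0 t_ge0.
by rewrite !(mulr_ge0, addr_ge0, exprn_ge0).
Qed.

Lemma trianglefree_spectral_bound (C : numClosedFieldType) (n m : nat)
    (B : 'M[C]_n) (M : 'M[C]_(n, m)) (a : 'cV[C]_n) :
  B^T = B -> (forall i j, 0 <= B i j) ->
  (forall i j k, B i j * B j k * B k i = 0) ->
  B + 1%:M = M *m M^t* - a *m a^t* ->
  (n <= 2 * m.+1)%N.
Proof.
move=> Bsym Bge0 Btri BE; set X := spectral_diag B.
pose g x : C := x ^+ 3 - 3 * x + 2.
(* A triangle with [i = j = k] is a loop, whose weight is the cube of a diagonal entry. *)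
have diag0 i : B i i = 0.
  by apply/eqP; move/eqP: (Btri i i i); rewrite !mulf_eq0 !orbb.
have sum_g : \sum_k g (X 0 k) = 2 *+ n.
  rewrite big_split sumrB /= -spectral_trace3 // -mulr_sumr -spectral_trace //.
  rewrite sumr_const card_ord [\tr B]big1 // mulr0 subr0.
  rewrite [\tr _]big1 ?add0r // => i _; rewrite !mxE big1 // => k _.
  by rewrite mxE mulr_suml big1 // => j _; rewrite Btri.
have rank_le : (\rank (B + 1%:M)%R <= m.+1)%N.
  rewrite BE -[m.+1]addn1; apply: leq_trans (mxrank_add _ _) _; apply: leq_add.
    exact: leq_trans (mxrankM_maxr _ _) (rank_leq_row _).
  rewrite -mulNmx; exact: leq_trans (mxrankM_maxr _ _) (rank_leq_row _).
pose S := [set k | X 0 k + 1 == 0].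
have S_big : (n <= #|S| + m.+1)%N.
  rewrite -[n in (n <= _)%N]card_ord -(cardsC S) leq_add2l.
  apply: leq_trans (leq_trans _ rank_le); last exact: (spectral_rank Bsym Bge0).
  by apply/subset_leq_card/fintype.subsetP=> k; rewrite !inE.
have gS k : k \in S -> g (X 0 k) = 4.
  by rewrite inE addr_eq0 => /eqP ->; rewrite /g; ring.
(* Then [4 * (n - m.+1) <= 2 * n], which is the claim. As [S] alone contributes [4 *+ #|S|], what
   remains is that the sum of [g] outside [S] is nonnegative. *)
suff : 4 *+ #|S| <= \sum_k g (X 0 k).
  rewrite sum_g -!mulrnA ler_nat => le_S.
  by move: S_big; rewrite -(leq_pmul2l (isT : 0 < 2)%N); lia.
rewrite (bigID (mem S)) /= (eq_bigr _ gS) sumr_const lerDl.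
have Xreal k : X 0 k \is Num.real by exact: spectral_real.
have geN1 k : ~~ (X 0 k + 1 < 0) -> 0 <= g (X 0 k).
  rewrite -real_leNgt ?realD ?real1 ?real0 // => Xk; apply: cubic_ge0.
  by rewrite -subr_ge0 opprK.
have [/existsP[j Xj]|/existsPn no] := boolP [exists j, X 0 j + 1 < 0];
  last first.
  by apply: sumr_ge0 => k _; apply: geN1.
have Xj' : X 0 j < -1 by rewrite -subr_lt0 opprK.
have Xj_lt0 := lt_trans Xj' (ltrN10 C).
have [k Xk] := spectral_perron Bsym Bge0 Xj_lt0.
have Xk_gt : 1 < X 0 k.
  apply: (@lt_le_trans _ _ (- X 0 j)); first by rewrite ltrNr.
  by rewrite -subr_ge0 opprK addrC.
have jS : j \notin S by rewrite inE lt_eqF.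
have kS : k \notin S by rewrite inE gt_eqF // addr_gt0 // (lt_trans ltr01).
have kj : k != j.
  apply: contraTneq Xk_gt => ->; rewrite -real_leNgt ?real1 //.
  exact: ltW (lt_trans Xj_lt0 ltr01).
(* The terms [j] and [k] are taken together; every other eigenvalue is at least [-1], as [j] is the
   only index below it. *)
rewrite (bigD1 j) //= (bigD1 k) /=; last by rewrite kS.
rewrite addrA addr_ge0 //.
  by apply: (@le_trans _ _ 4); [exact: ler0n | exact: cubic_pair_ge4 Xj' Xk].
apply: sumr_ge0 => i /andP[/andP[_ ij] _].
apply: (geN1 i); apply/negP => Xi.
have ji := spectral_one_negative Bsym Bge0 BE Xi Xj.
by rewrite ji eqxx in ij.
Qed.

(** * From point sets to matrices *)

Local Open Scope classical_set_scope.
Local Open Scope ring_scope.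

(** A finite or infinite [V] that is too large surjects onto [n.+1] indices; choosing preimages
    gives distinct points. *)
Lemma card_leIIPn (T : Type) (V : set T) (n : nat) :
  ~ (V #<= `I_n)%card ->
  exists2 p : 'I_n.+1 -> T, injective p & forall i, V (p i).
Proof.
move=> Vn.
have : (`I_n.+1 #<= V)%card.
  have [/finite_setP[m Vm]|/infiniteP] := pselect (finite_set V).
    move: Vn; rewrite (card_le_eql Vm) (card_le_eqr Vm) !card_le_II.
    by move/negP; rewrite -ltnNge.
  exact/card_le_trans/card_leT.
move=> /pcard_surjP[g g_surj].
have /choice[p pP] : forall i : 'I_n.+1, exists x, V x /\ g x = i.
  by move=> i; have [x] := g_surj i (ltn_ord i); exists x.
exists p => [i j pij|i]; last by case: (pP i).
by apply: val_inj; have [_ /= <-] := pP i; have [_ <-] := pP j; rewrite pij.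
Qed.

Definition sqdist (R : realType) (d : nat) (x y : 'rV[R]_d) : R :=
  \sum_(k < d) (x ord0 k - y ord0 k) ^+ 2.

Lemma sqdist_ge0 (R : realType) (d : nat) (x y : 'rV[R]_d) : 0 <= sqdist x y.
Proof. by apply: sumr_ge0 => k _; rewrite sqr_ge0. Qed.

Lemma edist_sqr (R : realType) (d : nat) (x y : 'rV[R]_d) :
  edist x y ^+ 2 = sqdist x y.
Proof. by rewrite sqr_sqrtr ?sqdist_ge0. Qed.

Lemma sqdist_diameter_le1 (R : realType) (d : nat) (V : set 'rV[R]_d) x y :
  diameter V = 1%:E -> V x -> V y -> sqdist x y <= 1.
Proof.
move=> V1 Vx Vy; rewrite -edist_sqr expr_le1 ?sqrtr_ge0 // -lee_fin -V1.
by apply: ereal_sup_ubound; exists (x, y).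
Qed.

(** With [a] the squared norms, [1 - |x - y|^2 = 2 <x, y> + (1 - |x|^2) (1 - |y|^2) - |x|^2 |y|^2];
    the middle product is the extra column of [N]. *)
Lemma gram_decomposition (R : realType) (n d : nat) (p : 'I_n -> 'rV[R]_d) :
  exists (N : 'M[R]_(n, d + 1)) (a : 'cV[R]_n),
    \matrix_(i, j) (1 - sqdist (p i) (p j)) = N *m N^T - a *m a^T.
Proof.
pose a : 'cV[R]_n := \col_i (p i *m (p i)^T) 0 0.
exists (row_mx (Num.sqrt 2 *: \matrix_i p i) (const_mx 1 - a)), a.
rewrite tr_row_mx mul_row_col linearZ /= -scalemxAl -scalemxAr scalerA.
rewrite -expr2 sqr_sqrtr //; apply/matrixP=> i j.
rewrite !mxE !big_ord1 !mxE.
have -> : sqdist (p i) (p j) = \sum_k p i 0 k * (p i)^T k 0 +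
    \sum_k p j 0 k * (p j)^T k 0 -
    2 * \sum_k (\matrix_i p i) i k * (\matrix_i p i)^T k j.
  rewrite mulr_sumr -big_split -sumrB; apply: eq_bigr => k _ /=.
  by rewrite !mxE; ring.
by ring.
Qed.

Theorem theorem9 (R : realType) (d : nat) (hd : (1 <= d)%N)
  (V : set 'rV[R]_d) (hV : almost_equidistant_diameter_set V) :
  (V #<= `I_(2 * d + 4)%N)%card.
Proof.
have [V_ae V_diam] := hV.
apply: contrapT => /card_leIIPn[p p_inj pV].
set n := (2 * d + 4)%N.+1 in p p_inj pV.
have [N [a NaE]] := gram_decomposition p.
pose A : 'M[R]_n := \matrix_(i, j) (1 - sqdist (p i) (p j)).
(* The spectral bound lives over a closed field; on real matrices the conjugate transpose is the
   transpose. *)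
pose toC : {rmorphism R -> R[i]} := real_complex R.
have mapJ r s (Q : 'M[R]_(r, s)) : (map_mx toC Q)^t* = map_mx toC Q^T.
  by apply/matrixP=> i j; rewrite !mxE; exact: conjc_real.
have Aii i : A i i = 1.
  by rewrite mxE [sqdist _ _]big1 ?subr0 // => k _; rewrite subrr expr0n.
have Aij_eq0 i j : edist (p i) (p j) = 1 -> A i j = 0.
  by rewrite mxE -edist_sqr => ->; rewrite expr1n subrr.
have A_sym i j : A i j = A j i.
  by rewrite !mxE; congr (1 - _); apply: eq_bigr => k _; rewrite -sqrrN opprB.
have A_ge0 i j : 0 <= A i j.
  by rewrite mxE subr_ge0 (sqdist_diameter_le1 V_diam).
pose B := A - 1%:M.
have BE i j : B i j = A i j - (i == j)%:R by rewrite !mxE.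
have Bii i : B i i = 0 by rewrite BE Aii eqxx subrr.
have Bij i j : i != j -> B i j = A i j.
  by move=> /negPf ij; rewrite BE ij subr0.
have BCE i j : map_mx toC B i j = toC (B i j) by rewrite mxE.
(* The right side is [2 * d + 4], one less than [n]. *)
suff : (n <= 2 * (d + 1).+1)%N by rewrite /n; lia.
apply: (@trianglefree_spectral_bound _ n (d + 1) (map_mx toC B)
  (map_mx toC N) (map_mx toC a)).
- by apply/matrixP=> i j; rewrite mxE !BCE !BE A_sym eq_sym.
- move=> i j; rewrite BCE ler0c; have [->|ij] := eqVneq i j.
    by rewrite Bii.
  by rewrite Bij.
- move=> i j k; rewrite !BCE -!rmorphM /= -[RHS](rmorph0 toC); congr (toC _).
  (* Equal indices give a zero diagonal entry; three distinct points have a pair at distance 1,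
     whose entry of [A] is zero. *)
  have [->|ij] := eqVneq i j; first by rewrite Bii !mul0r.
  have [->|jk] := eqVneq j k; first by rewrite Bii mulr0 mul0r.
  have [->|ki] := eqVneq k i; first by rewrite Bii mulr0.
  have pN x y : x != y -> p x <> p y by move=> /eqP xy /p_inj.
  rewrite !Bij // (A_sym k).
  have pik : p i <> p k by apply: pN; rewrite eq_sym.
  have [|[]] := V_ae _ _ _ (pV i) (pV j) (pV k) (pN _ _ ij) (pN _ _ jk) pik;
    by move=> /Aij_eq0 ->; rewrite !(mul0r, mulr0).
- by rewrite !mapJ -!map_mxM -map_mxB -NaE -(map_mx1 toC) -map_mxD subrK.
Qed.
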